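(* Consider the control system $\dot x(t)=f(x(t))+g(x(t))u(t)$ with $x\in\mathbb{R}^n$, $u\in U$, where $U\subseteq\mathbb{R}^m$ is compact and $f:\mathbb{R}^n\to\mathbb{R}^n$, $g:\mathbb{R}^n\to\mathbb{R}^{n\times m}$ are $r$-times continuously differentiable, $r\ge 1$. Let $h:\mathbb{R}^n\to\mathbb{R}$ be of relative-degree $r$ with respect to this system and let $S=\{x\in\mathbb{R}^n : h(x)\le 0\}$. Suppose the maximum $$a_{max}=\max\Big\{a\in\mathbb{R} : \forall x\in S,\ \exists v\in (L_gL_f^{r-1}h(x))^\perp \text{ with } -\frac{(a+L_f^rh(x))\,(L_gL_f^{r-1}h(x))^{\mathrm T}}{\|L_gL_f^{r-1}h(x)\|^2}+v\in U\Big\}$$ exists and $a_{max}>0$ (in particular $L_gL_f^{r-1}h(x)\neq0$ for $x\in S$). Let $$\boldsymbol\mu(x)=\{u\in U : L_f^rh(x)+L_gL_f^{r-1}h(x)u=-a_{max}\},$$ and suppose there is a control law $u':\mathbb{R}^n\to U$ with $u'(x)\in\boldsymbol\mu(x)$ for all $x\in\mathbb{R}^n$ such that for every $x(0)\in S$ the closed-loop system $\dot x=f(x)+g(x)u'(x)$ admits a unique solution $x(t)$, $t\ge0$. Define $$\psi_h(t;x,u')=\sum_{i=0}^{r-1}\frac{1}{i!}L_f^ih(x)\,t^i-\frac{1}{r!}a_{max}t^r,$$ $$t_c'(x)=\operatorname*{arg\,max}_{t\ge0}\psi_h(t;x,u'),\qquad H'(x)=\max_{t\ge 0}\psi_h(t;x,u')=\psi_h(t_{c,0}';x,u')\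 \ \forall t_{c,0}'\in t_c'(x),$$ $$S_{H'}=\{x\in\mathbb{R}^n : H'(x)\le0\},\qquad U'=\{u\in U : \exists x\in S,\ u\in\boldsymbol\mu(x)\}.$$ Assume $S_{H'}\ne\emptyset$. Then $H'$ is a zeroing control barrier function on $S_{H'}$ for the control set $U'$, and likewise for the control set $U$; that is, for each $W\in\{U',U\}$ there exists an extended class-$\mathcal{K}$ function $\alpha$ such that $$\inf_{u\in W}\left[\dot H'(x,u)-\alpha(-H'(x))\right]\le0\qquad\text{for all }x\in S_{H'},$$ where $$\dot H'(x,u)=\max_{t_{c,0}'\in t_c'(x)}\ \frac{\partial\psi_h(t_{c,0}';x,u')}{\partial x}\big(f(x)+g(x)u\big).$$
   Context: Lie derivatives: for a real-valued function $\phi$ on $\mathbb{R}^n$ differentiable at $x$, $L_f\phi(x)=\frac{\partial \phi}{\partial x}(x)f(x)\in\mathbb{R}$ and $L_g\phi(x)=\frac{\partial\phi}{\partial x}(x)g(x)\in\mathbb{R}^{1\times m}$; $L_f^0\phi=\phi$, $L_f^{k}\phi=L_f(L_f^{k-1}\phi)$. For $w\in\mathbb{R}^m$ (row or column), $w^\perp=\{v\in\mathbb{R}^m : w\cdot v=0\}$; $\|\cdot\|$ is the Euclidean norm. Relative degree: $h:\mathbb{R}^n\to\mathbb{R}$ is of relative-degree $r$ with respect to the system if (1) $h$ is $r$-times continuously differentiable; (2) $L_gL_f^kh(x)=0$ for all $x\in\mathbb{R}^n$ and all $k=0,1,\dots,r-2$ (vacuous if $r=1$); (3) there is a nonempty set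 $C\subseteq\mathbb{R}^n$ such that $L_gL_f^{r-1}h(x)\ne 0$ for all $x\in C$. For such $h$, the time derivatives along the system are $h^{(i)}(x)=L_f^ih(x)$ for $i\le r-1$ and $h^{(r)}(x,u)=L_f^rh(x)+L_gL_f^{r-1}h(x)u$. Extended class-$\mathcal{K}$: $\alpha:\mathbb{R}\to\mathbb{R}$ that is strictly increasing with $\alpha(0)=0$. The polynomial $\psi_h(t;x,u')$ is the value of $h$ at time $t$ along the closed-loop trajectory starting at $x$ under $u'$, along which $h^{(r)}=-a_{max}$. In $\frac{\partial\psi_h(t_{c,0}';x,u')}{\partial x}$, the time $t_{c,0}'$ is held fixed and the polynomial is differentiated with respect to $x$. Zeroing control barrier function (ZCBF): for a differentiable function $H$ and control set $W$, $H$ is a ZCBF on $\{H\le0\}$ if for some extended class-$\mathcal K$ function $\alpha$, $\inf_{u\in W}[L_fH(x)+L_gH(x)u-\alpha(-H(x))]\le0$ on $\{H\le 0\}$. Since $H'$ need not be differentiable where $t_c'(x)$ has several elements, $L_fH'+L_gH'u$ is replaced by $\dot H'(x,u)$ as given in the claim (the two agree when $t_c'(x)$ is a singleton). *)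

(* Defs.v *)
From HB Require Import structures.
From mathcomp Require Import all_boot all_order all_algebra.
From mathcomp Require Import all_classical all_reals all_analysis.

Set Implicit Arguments.
Unset Strict Implicit.
Unset Printing Implicit Defensive.

Import Order.TTheory GRing.Theory Num.Theory.
Import numFieldNormedType.Exports.

Local Open Scope classical_set_scope.
Local Open Scope ring_scope.

(* On the finite-dimensional space 'cV_n it suffices to ask for differentiability
   and for C^k regularity of the directional derivatives. *)
Fixpoint times_cdiff (R : realType) (n : nat) (W : normedModType R) (k : nat)
    (phi : 'cV[R]_n -> W) : Prop :=
  match k with
  | 0%N => continuous phi
  | k'.+1 => (forall x, differentiable phi x) /\
             (forall v, times_cdiff k' (fun x => 'D_v phi x))
  end.

(* The library norm on matrices is the sup norm. *)
Definition enorm (R : realType) (m : nat) (w : 'rV[R]_m) : R :=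
  Num.sqrt (\sum_j w 0 j ^+ 2).

Definition perp (R : realType) (m : nat) (w : 'rV[R]_m) : set 'cV[R]_m :=
  [set v | w *m v = 0].

Definition is_max (R : realType) (A : set R) (a : R) : Prop :=
  A a /\ ubound A a.

(* Not required to be continuous. *)
Definition ext_classK (R : realType) (alpha : R -> R) : Prop :=
  {homo alpha : s t / s < t} /\ alpha 0 = 0.

(* Classical solutions on [0, +oo[; the derivative at 0 is one-sided. *)
Definition is_solution (R : realType) (n : nat) (F : 'cV[R]_n -> 'cV[R]_n)
    (x0 : 'cV[R]_n) (x : R -> 'cV[R]_n) : Prop :=
  x 0 = x0 /\
  forall t, 0 <= t ->
    s^-1 *: (x (t + s) - x t) @[s --> within [set s | 0 <= t + s] 0^']
      --> F (x t).

Definition has_unique_solution (R : realType) (n : nat)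
    (F : 'cV[R]_n -> 'cV[R]_n) (x0 : 'cV[R]_n) : Prop :=
  exists2 x, is_solution F x0 x &
    forall y, is_solution F x0 y -> forall t, 0 <= t -> y t = x t.

Section control_system.
Context (R : realType) (n m : nat).
Context (f : 'cV[R]_n -> 'cV[R]_n) (g : 'cV[R]_n -> 'M[R]_(n, m)).

Definition Lf (phi : 'cV[R]_n -> R) (x : 'cV[R]_n) : R := 'd phi x (f x).

Definition Lfn (k : nat) (phi : 'cV[R]_n -> R) : 'cV[R]_n -> R :=
  iter k Lf phi.

Definition Lg (phi : 'cV[R]_n -> R) (x : 'cV[R]_n) : 'rV[R]_m :=
  \row_j 'd phi x (col j (g x)).

Definition relative_degree (r : nat) (h : 'cV[R]_n -> R) : Prop :=
  [/\ times_cdiff r h,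
      forall k, (k.+1 < r)%N -> forall x, Lg (Lfn k h) x = 0
    & exists2 C : set 'cV[R]_n, C !=set0 &
        forall x, C x -> Lg (Lfn r.-1 h) x <> 0].

Context (U : set 'cV[R]_m) (r : nat) (h : 'cV[R]_n -> R).

Definition safe_set : set 'cV[R]_n := [set x | h x <= 0].

(* Meaningful only when Lg (Lfn r.-1 h) does not vanish on safe_set. *)
Definition admissible_rates : set R :=
  [set a | forall x, safe_set x ->
    exists2 v, perp (Lg (Lfn r.-1 h) x) v &
      U (- (((a + Lfn r h x) / enorm (Lg (Lfn r.-1 h) x) ^+ 2)
              *: (Lg (Lfn r.-1 h) x)^T) + v)].

Context (amax : R).

Definition mu (x : 'cV[R]_n) : set 'cV[R]_m :=
  [set u | U u /\ Lfn r h x + (Lg (Lfn r.-1 h) x *m u) 0 0 = - amax].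

Definition psi (t : R) (x : 'cV[R]_n) : R :=
  \sum_(i < r) (i`!%:R)^-1 * Lfn i h x * t ^+ i
    - (r`!%:R)^-1 * amax * t ^+ r.

Definition tc (x : 'cV[R]_n) : set R :=
  [set t | 0 <= t /\ forall s, 0 <= s -> psi s x <= psi t x].

(* The suprema in H' and Hdot' are maxima as soon as 0 < r and 0 < amax: see
   H'_is_max and Hdot'_is_max. *)
Definition H' (x : 'cV[R]_n) : R := sup [set psi t x | t in [set t | 0 <= t]].

Definition Hdot' (x : 'cV[R]_n) (u : 'cV[R]_m) : R :=
  sup [set 'd (psi t) x (f x + g x *m u) | t in tc x].

Definition U' : set 'cV[R]_m :=
  [set u | U u /\ exists2 x, safe_set x & mu x u].

End control_system.

(* The infimum is taken in the extended reals, so that it is +oo for an empty W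
   and -oo when the values are unbounded below. Hdot x u stands for
   L_f H (x) + L_g H (x) u. *)
Definition is_ZCBF (R : realType) (n m : nat) (H : 'cV[R]_n -> R)
    (Hdot : 'cV[R]_n -> 'cV[R]_m -> R) (W : set 'cV[R]_m) : Prop :=
  exists2 alpha : R -> R, ext_classK alpha &
    forall x, H x <= 0 ->
      (ereal_inf [set (Hdot x u - alpha (- H x))%:E | u in W] <= 0)%E.

Lemma is_max_sup (R : realType) (A : set R) (a : R) : is_max A a -> sup A = a.
Proof.
move=> [Aa uAa]; apply/eqP; rewrite eq_le; apply/andP; split.
  by apply: ge_sup => //; exists a.
by apply: ub_le_sup => //; exists a.
Qed.

Section maxima_attained.
Context (R : realType) (n m : nat).
Context (f : 'cV[R]_n -> 'cV[R]_n) (g : 'cV[R]_n -> 'M[R]_(n, m)).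
Context (r : nat) (h : 'cV[R]_n -> R) (amax : R).
Context (r_gt0 : (0 < r)%N) (amax_gt0 : 0 < amax).

Let p (x : 'cV[R]_n) : {poly R} :=
  \poly_(i < r.+1) (if (i < r)%N then (i`!%:R)^-1 * Lfn f i h x
                    else - ((r`!%:R)^-1 * amax)).

Let psiE t x : psi f r h amax t x = (p x).[t].
Proof.
rewrite horner_poly big_ord_recr /= ltnn mulNr; congr (_ - _).
by apply: eq_bigr => i _; rewrite ltn_ord.
Qed.

Lemma tc_neq0 x : tc f r h amax x !=set0.
Proof.
pose c : R := (r`!%:R)^-1 * amax.
have c0 : 0 < c by rewrite mulr_gt0// invr_gt0 ltr0n fact_gt0.
pose C := \sum_(i < r) `|(i`!%:R)^-1 * Lfn f i h x|.
have C0 : 0 <= C by exact: sumr_ge0.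
pose T := 1 + (C + `|psi f r h amax 0 x|) / c.
have T1 : 1 <= T by rewrite lerDl divr_ge0 ?addr_ge0// ltW.
have T0 : 0 <= T := le_trans ler01 T1.
have far t : T <= t -> psi f r h amax t x <= psi f r h amax 0 x.
  move=> Tt.
  have t1 : 1 <= t := le_trans T1 Tt.
  have t0 : 0 <= t := le_trans ler01 t1.
  have tr : 1 <= t ^+ r.-1 by exact: exprn_ege1.
  apply: (@le_trans _ _ (t ^+ r.-1 * (C - c * t))).
    rewrite mulrBr /psi -/c; apply: lerB; last first.
      by rewrite mulrCA -exprSr prednK.
    rewrite mulr_sumr; apply: ler_sum => i _.
    rewrite mulrC; apply: (le_trans (ler_norm _)); rewrite normrM.
    apply: ler_wpM2r => //.
    rewrite ger0_norm ?exprn_ge0//.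
    by apply: ler_weXn2l => //; rewrite -ltnS prednK.
  have Cct : C - c * t <= - `|psi f r h amax 0 x|.
    rewrite lerBlDr addrC -lerBlDr opprK.
    rewrite mulrC -ler_pdivrMr//; apply: le_trans Tt.
    by rewrite /T lerDr.
  apply: (@le_trans _ _ (t ^+ r.-1 * - `|psi f r h amax 0 x|)).
    by rewrite ler_wpM2l// (le_trans ler01).
  rewrite mulrN; apply: (@le_trans _ _ (- `|psi f r h amax 0 x|)).
    by rewrite lerN2 ler_peMl.
  by rewrite lerNl -normrN ler_norm.
have [t /itvP tT tmax] : exists2 c, c \in `[0, T] & forall t, t \in `[0, T] ->
    psi f r h amax t x <= psi f r h amax c x.
  apply: EVT_max => //; apply: continuous_subspaceT.
  rewrite (_ : (psi f r h amax)^~ x = horner (p x)); last first.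
    by apply/funext => s; rewrite psiE.
  exact: continuous_horner.
exists t; split => [|s s0]; first by rewrite tT.
have [sT|Ts] := leP s T; first by apply: tmax; rewrite in_itv/= s0.
apply: (le_trans (far _ (ltW Ts))); apply: tmax.
by rewrite in_itv/= lexx.
Qed.

Lemma tc_finite x : finite_set (tc f r h amax x).
Proof.
have [t0 [t00 t0max]] := tc_neq0 x.
pose q := p x - (psi f r h amax t0 x)%:P.
have q0 : q != 0.
  apply/eqP => /(congr1 (fun q : {poly R} => q`_r)).
  rewrite coef0 coefB coef_poly ltnSn ltnn coefC gtn_eqF// subr0.
  apply/eqP; rewrite oppr_eq0; apply/lt0r_neq0/mulr_gt0 => //.
apply: contrapT => /(infinite_set_fset (size q))[B Bsub].
apply/negP; rewrite -ltnNge; apply: max_poly_roots => //; last first.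
  exact: finmap.fset_uniq.
apply/allP => t tB; have [t_ge0 tmax] := Bsub _ tB.
rewrite /root hornerD hornerN hornerC -psiE subr_eq0 eq_le.
by rewrite t0max// tmax.
Qed.

Lemma H'_is_max x :
  is_max [set psi f r h amax t x | t in [set t | 0 <= t]] (H' f r h amax x) /\
  forall t, tc f r h amax x t -> H' f r h amax x = psi f r h amax t x.
Proof.
have tcmax t : tc f r h amax x t ->
    is_max [set psi f r h amax t x | t in [set t | 0 <= t]] (psi f r h amax t x).
  by move=> [t0 tmax]; split; [exists t | move=> _ [s s0 <-]; exact: tmax].
have [t tct] := tc_neq0 x; split => [|s tcs].
  by rewrite /H' (is_max_sup (tcmax _ tct)); exact: tcmax.
exact: is_max_sup (tcmax _ tcs).
Qed.

Lemma Hdot'_is_max x u :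
  is_max [set 'd (psi f r h amax t) x (f x + g x *m u) | t in tc f r h amax x]
    (Hdot' f g r h amax x u).
Proof.
set A := [set _ | _ in _].
have finA : finite_set A by apply: finite_image; exact: tc_finite.
have [t tct] := tc_neq0 x.
have [||c /set_mem Ac Amax] := @compact_EVT_max R R id A _ (finite_compact finA).
- by exists ('d (psi f r h amax t) x (f x + g x *m u)); exists t.
- by apply: continuous_subspaceT => ?; exact: cvg_id.
have mc : is_max A c by split => // a Aa; apply: Amax; exact: mem_set.
by rewrite /Hdot' -/A (is_max_sup mc).
Qed.

End maxima_attained.

(* Main.v *)
(** Under [u'] the function [h] follows the polynomial [psi] in time, so the
    derivative of [psi t] along the closed-loop field equals the time
    derivative of [psi] at [t].  At a maximiser over [0 <= t] the latter is
    nonpositive (zero in the interior, one-sided at [0]), so the control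
    [u' x] makes [Hdot'] nonpositive, and any extended class-K function will
    do; we take the identity. *)

Require Import Defs.
From HB Require Import structures.
From mathcomp Require Import all_boot all_order all_algebra.
From mathcomp Require Import all_classical all_reals all_analysis.

Set Implicit Arguments.
Unset Strict Implicit.
Unset Printing Implicit Defensive.

Import Order.TTheory GRing.Theory Num.Theory.
Import numFieldNormedType.Exports.

Local Open Scope classical_set_scope.
Local Open Scope ring_scope.

(** * Closure of C^k regularity under the operations that build iterated Lie derivatives *)

Section times_cdiff_theory.
Context (R : realType) (n : nat).

Lemma times_cdiff_pred (W : normedModType R) k (phi : 'cV[R]_n -> W) :
  times_cdiff k.+1 phi -> times_cdiff k phi.
Proof.
elim: k phi => [|k IH] phi [dphi Dphi].
  by move=> x; exact: differentiable_continuous.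
by split => // v; apply: IH; exact: Dphi.
Qed.

Lemma times_cdiff_le (W : normedModType R) k l (phi : 'cV[R]_n -> W) :
  (k <= l)%N -> times_cdiff l phi -> times_cdiff k phi.
Proof.
move=> /subnK <-; elim: (l - k)%N => [//|d IH] Cphi.
exact/IH/times_cdiff_pred.
Qed.

Lemma times_cdiff_cst (W : normedModType R) k (c : W) :
  times_cdiff k (fun _ : 'cV[R]_n => c).
Proof.
elim: k c => [|k IH] c; first exact: cst_continuous.
split => [x|v]; first exact: differentiable_cst.
have -> : 'D_v (fun _ : 'cV[R]_n => c) = (fun _ => 0); last exact: IH.
by apply/funext => x; exact: derive_cst.
Qed.

Lemma times_cdiffD (W : normedModType R) k (phi chi : 'cV[R]_n -> W) :
  times_cdiff k phi -> times_cdiff k chi -> times_cdiff k (phi + chi).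
Proof.
elim: k phi chi => [|k IH] phi chi.
  by move=> cphi cchi x; exact: continuousD (cphi x) (cchi x).
move=> [dphi Dphi] [dchi Dchi]; split => [x|v]; first exact: differentiableD.
have -> : 'D_v (phi + chi) = 'D_v phi + 'D_v chi.
  by apply/funext => x; rewrite deriveD//; exact: diff_derivable.
exact: IH (Dphi v) (Dchi v).
Qed.

Lemma times_cdiff_sum (W : normedModType R) k p (phi : 'I_p -> 'cV[R]_n -> W) :
  (forall i, times_cdiff k (phi i)) -> times_cdiff k (\sum_(i < p) phi i).
Proof.
move=> Cphi; apply: big_ind => //; first exact: times_cdiff_cst.
by move=> *; exact: times_cdiffD.
Qed.

(** Leibniz rule: each summand pairs the derivative of one factor with the other factor
    undifferentiated, which has an order to spare. *)
Lemma times_cdiffM k (phi chi : 'cV[R]_n -> R) :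
  times_cdiff k phi -> times_cdiff k chi -> times_cdiff k (phi * chi).
Proof.
elim: k phi chi => [|k IH] phi chi.
  by move=> cphi cchi x; exact: continuousM (cphi x) (cchi x).
move=> Cphi Cchi; have [dphi Dphi] := Cphi; have [dchi Dchi] := Cchi.
split => [x|v]; first exact: differentiableM.
have -> : 'D_v (phi * chi) = phi * 'D_v chi + chi * 'D_v phi.
  by apply/funext => x; rewrite deriveM//; exact: diff_derivable.
apply: times_cdiffD.
  exact: IH (times_cdiff_pred Cphi) (Dchi v).
exact: IH (times_cdiff_pred Cchi) (Dphi v).
Qed.

Lemma times_cdiff_coord k p q (M : 'cV[R]_n -> 'M[R]_(p, q)) i j :
  times_cdiff k M -> times_cdiff k (fun x => M x i j).
Proof.
elim: k M => [|k IH] M.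
  move=> cM x.
  exact: (continuous_comp (f := M) (cM x) (@coord_continuous R p q i j (M x))).
move=> [dM DM]; split => [x|v].
  exact: (differentiable_comp (dM x) (differentiable_coord _ i j)).
have -> : 'D_v (fun x => M x i j) = (fun x => 'D_v M x i j); last exact: IH (DM v).
by apply/funext => x; rewrite derive_mx ?mxE//; exact: diff_derivable.
Qed.

(** In the standard basis [Lf f phi] is the sum of the coordinates of [f] times the partial
    derivatives of [phi], so only [phi] loses an order. *)
Lemma times_cdiff_Lf k (f : 'cV[R]_n -> 'cV[R]_n) (phi : 'cV[R]_n -> R) :
  times_cdiff k f -> times_cdiff k.+1 phi -> times_cdiff k (Lf f phi).
Proof.
move=> Cf [dphi Dphi].
rewrite (_ : Lf f phi =
    \sum_(j < n) (fun x => f x j 0) * (fun x => 'D_(delta_mx j 0) phi x)).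
  apply: times_cdiff_sum => j.
  exact: times_cdiffM (times_cdiff_coord j 0 Cf) (Dphi _).
apply/funext => x; rewrite /Lf fct_sumE {1}(matrix_sum_delta (f x)) linear_sum.
by apply: eq_bigr => j _; rewrite big_ord1 linearZ/= -deriveE.
Qed.

(** Each Lie derivative costs one order. The case [l = 1] is what makes the iterated Lie derivatives
    of [h] differentiable. *)
Lemma times_cdiff_Lfn k l (f : 'cV[R]_n -> 'cV[R]_n) (phi : 'cV[R]_n -> R) :
  times_cdiff (l + k) f -> times_cdiff (l + k) phi ->
  times_cdiff l (Lfn f k phi).
Proof.
elim: k l => [|k IH] l; first by rewrite addn0.
rewrite addnS => Cf Cphi; apply: times_cdiff_Lf; last exact: IH.
exact: times_cdiff_le (leqW (leq_addr k l)) Cf.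
Qed.

End times_cdiff_theory.

(** The derivative is the limit of the difference quotients from the right, all of them nonpositive.
    Looking only to the right treats a maximiser at [0] and an interior one alike. *)
Lemma derive_le0_right_max (R : realType) (F : R -> R) (t : R) :
  derivable F t 1 -> (forall s, t <= s -> F s <= F t) -> 'D_1 F t <= 0.
Proof.
move=> dF Fmax; rewrite ['D_1 F t]cvg_at_rightE//.
apply: limr_le.
  by apply/cvg_ex; exists ('D_1 F t); exact: cvg_dnbhs_at_right.
near=> s; have s0 : 0 < s by near: s; exact: nbhs_right_gt.
apply: mulr_ge0_le0; first by rewrite invr_ge0 ltW.
by rewrite subr_le0 [_%:A]mulr1; apply: Fmax; rewrite lerDr ltW.
Unshelve. all: by end_near. Qed.

Lemma diff_dotE (R : realType) (n m : nat) (f : 'cV[R]_n -> 'cV[R]_n)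
    (g : 'cV[R]_n -> 'M[R]_(n, m)) (phi : 'cV[R]_n -> R) x u :
  'd phi x (f x + g x *m u) = Lf f phi x + (Lg g phi x *m u) 0 0.
Proof.
rewrite linearD/= /Lf; congr (_ + _).
have -> : g x *m u = \sum_j u j 0 *: col j (g x).
  apply/colP => i; rewrite summxE mxE; apply: eq_bigr => j _.
  by rewrite !mxE mulrC.
rewrite linear_sum mxE; apply: eq_bigr => j _.
by rewrite linearZ/= /Lg mxE mulrC.
Qed.

(** * Time and space derivatives of the polynomial [psi] *)

Section psi_derivatives.
Context (R : realType) (n m : nat).
Context (f : 'cV[R]_n -> 'cV[R]_n) (g : 'cV[R]_n -> 'M[R]_(n, m)).
Context (U : set 'cV[R]_m) (k : nat) (h : 'cV[R]_n -> R) (amax : R).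

Lemma psi_is_derive1 (x : 'cV[R]_n) (t : R) :
  is_derive (t : R) (1 : R) (fun s : R => psi f k.+1 h amax s x)
    (\sum_(i < k) (i`!%:R)^-1 * Lfn f i.+1 h x * t ^+ i
       - (k`!%:R)^-1 * amax * t ^+ k).
Proof.
(* The factor [i.+1] produced by the power rule cancels against the factorial; this serves both the
   sum and the leading term. *)
have coefS i (a b : R) :
    ((i.+1`!%:R)^-1 * a) *: ((i.+1%:R * b) *: 1) = (i`!%:R)^-1 * a * b :> R.
  rewrite [_ *: 1]mulr1 [_ *: _]mulrA; congr (_ * _).
  rewrite mulrAC; congr (_ * _).
  by rewrite factS natrM invfM mulrAC mulVf ?mul1r// pnatr_eq0.
rewrite (_ : (fun s => _) =
    \sum_(i < k.+1) ((i`!%:R)^-1 * Lfn f i h x) \*: (id ^+ i : R -> R)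
    - ((k.+1)`!%:R^-1 * amax) \*: (id ^+ k.+1 : R -> R)); last first.
  apply/funext => s; rewrite /psi !fctE fct_sumE; congr (_ - _).
  by apply: eq_bigr => i _; rewrite fctE.
(* The constant term drops out, which shifts the index so that [Lfn f i.+1 h x] meets [t ^+ i]. *)
apply: is_derive_eq; rewrite big_ord_recl/= mul0r scale0r scaler0 add0r.
congr (_ - _); last exact: coefS.
by apply: eq_bigr => i _; exact: coefS.
Qed.

Hypothesis dLfn : forall i, (i <= k)%N -> forall x, differentiable (Lfn f i h) x.

Lemma diff_psi t x v :
  'd (psi f k.+1 h amax t) x v =
  \sum_(i < k.+1) (i`!%:R)^-1 * t ^+ i * 'd (Lfn f i h) x v.
Proof.
rewrite (_ : psi f k.+1 h amax t =
    \sum_(i < k.+1) ((i`!%:R)^-1 * t ^+ i) \*: Lfn f i h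
    - cst (((k.+1)`!%:R)^-1 * amax * t ^+ k.+1)); last first.
  apply/funext => y; rewrite /psi !fctE fct_sumE; congr (_ - _).
  by apply: eq_bigr => i _; rewrite mulrAC.
have dZ (i : 'I_k.+1) :
    differentiable (((i`!%:R)^-1 * t ^+ i) \*: Lfn f i h) x.
  by apply: differentiableZ; apply: dLfn; rewrite -ltnS.
have dS := differentiable_sum dZ.
rewrite -deriveE; last by apply: differentiableB => //; exact: differentiable_cst.
rewrite deriveB; [|exact: diff_derivable|exact: derivable_cst].
rewrite derive_cst subr0 derive_sum; last by move=> i; exact: diff_derivable.
apply: eq_bigr => i _; have di : differentiable (Lfn f i h) x.
  by apply: dLfn; rewrite -ltnS.
by rewrite deriveZ ?deriveE//; exact: diff_derivable.
Qed.

Hypothesis LgLfn0 : forall i, (i < k)%N -> forall x, Lg g (Lfn f i h) x = 0.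

(** Below the top index the relative degree removes the control, so [Lfn f i h] turns into
    [Lfn f i.+1 h] as under time differentiation. At the top index [k], membership in [mu] makes the
    derivative [- amax], which matches the leading term. *)
Lemma diff_psi_mu t x u : mu f g U k.+1 h amax x u ->
  'd (psi f k.+1 h amax t) x (f x + g x *m u) =
  'D_1 (fun s => psi f k.+1 h amax s x) t.
Proof.
move=> [_ uE]; rewrite (@derive_val _ _ _ _ _ _ _ (psi_is_derive1 x t)).
rewrite diff_psi big_ord_recr/= diff_dotE uE mulrN mulrAC; congr (_ - _).
apply: eq_bigr => i _; rewrite diff_dotE LgLfn0// mul0mx mxE addr0.
by rewrite mulrAC.
Qed.

(** The maximum defining [Hdot'] is attained at some maximiser [t] in [tc], so the sign of the time
    derivative at that single [t] decides. *)
Lemma Hdot'_mu_le0 x u : 0 < amax ->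
  mu f g U k.+1 h amax x u -> Hdot' f g k.+1 h amax x u <= 0.
Proof.
move=> amax0 mu_u.
have [[t [t0 tmax] <-] _] := Hdot'_is_max f g h (ltn0Sn k) amax0 x u.
rewrite (diff_psi_mu _ mu_u); apply: derive_le0_right_max.
  by have [] := psi_is_derive1 x t.
by move=> s ts; apply: tmax; exact: le_trans ts.
Qed.

End psi_derivatives.

Theorem theorem2 (R : realType) (n m r : nat)
    (f : 'cV[R]_n -> 'cV[R]_n) (g : 'cV[R]_n -> 'M[R]_(n, m))
    (U : set 'cV[R]_m) (h : 'cV[R]_n -> R) (amax : R)
    (u' : 'cV[R]_n -> 'cV[R]_m)
    (r_ge1 : (1 <= r)%N)
    (U_compact : compact U)
    (f_Cr : times_cdiff r f)
    (g_Cr : times_cdiff r g)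
    (h_reldeg : relative_degree f g r h)
    (LgLfh_neq0 : forall x, safe_set h x -> Lg g (Lfn f r.-1 h) x <> 0)
    (amax_max : is_max (admissible_rates f g U r h) amax)
    (amax_gt0 : 0 < amax)
    (u'_U : forall x, U (u' x))
    (u'_mu : forall x, mu f g U r h amax x (u' x))
    (u'_sol : forall x0, safe_set h x0 ->
       has_unique_solution (fun x => f x + g x *m u' x) x0)
    (SH'_neq0 : exists x, H' f r h amax x <= 0) :
  is_ZCBF (H' f r h amax) (Hdot' f g r h amax) (U' f g U r h amax) /\
  is_ZCBF (H' f r h amax) (Hdot' f g r h amax) U.
Proof.
have [k rE] : exists k, r = k.+1 by exists r.-1; rewrite prednK.
subst r.
(* Evaluate [psi] at time [0], where only the term [h x] survives. Hence [H' <= 0] forces [x] into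
   the safe set, as membership of [u' x] in [U'] requires. *)
have h_le_H' x : h x <= H' f k.+1 h amax x.
  have [[_ +] _] := H'_is_max f h r_ge1 amax_gt0 x; apply; exists 0 => //=.
  rewrite /psi big_ord_recl big1 => [|i _].
    by rewrite exprS mul0r mulr0 subr0 addr0 invr1 mul1r mulr1.
  by rewrite exprS mul0r mulr0.
have Hdot'_le0 x : Hdot' f g k.+1 h amax x (u' x) <= 0.
  have [h_Cr Lg0 _] := h_reldeg.
  apply: (Hdot'_mu_le0 (U := U)) => // i ik y.
  (* Since [i <= k], the [k.+1] orders of [f] and [h] leave at least one after [i] Lie
     derivatives. *)
  have Cdecr (W : normedModType R) (phi : 'cV[R]_n -> W) :
      times_cdiff k.+1 phi -> times_cdiff (1 + i) phi.
    exact: times_cdiff_le.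
  by have [] := times_cdiff_Lfn (Cdecr _ _ f_Cr) (Cdecr _ _ h_Cr).
(* Both control sets contain [u' x] on the safe set. With the identity as class-K function, the
   value at [u' x] is [Hdot' + H'], a sum of two nonpositive terms that bounds the infimum. *)
have zcbf (W : set 'cV[R]_m) : (forall x, safe_set h x -> W (u' x)) ->
    is_ZCBF (H' f k.+1 h amax) (Hdot' f g k.+1 h amax) W.
  move=> W_u'; exists id; first by split.
  move=> x H'x; apply: (@le_trans _ _
    (Hdot' f g k.+1 h amax x (u' x) - - H' f k.+1 h amax x)%:E).
    apply: ereal_inf_lbound; exists (u' x) => //; apply: W_u'.
    exact: le_trans H'x.
  by rewrite lee_fin opprK -[leRHS]addr0 lerD.
split; apply: zcbf => x Sx; last exact: u'_U.
by split; [exact: u'_U|exists x].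
Qed.
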